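(* Let $F:\mathbb{R}^n\rightrightarrows\mathbb{R}^q$ be a polyhedral convex set-valued mapping with natural ordering cone $K$, and let $C\subseteq\mathbb{R}^q$ be a polyhedral convex cone which is regular for $F$. Then the problem (P), $\min F(x)+C$ s.t. $x\in\mathbb{R}^n$, has a solution if and only if (i) the vectorial relaxation (VR) of (P) has a solution, and (ii) $C\supseteq K$.
   Context: A set-valued mapping $F:\mathbb{R}^n\rightrightarrows\mathbb{R}^q$ assigns to each $x\in\mathbb{R}^n$ a (possibly empty) subset $F(x)\subseteq\mathbb{R}^q$; $\operatorname{gr}F=\{(x,y): y\in F(x)\}$ and $\operatorname{dom}F=\{x: F(x)\neq\emptyset\}$. $F$ is polyhedral convex if $\operatorname{gr}F$ is a convex polyhedron. A polyhedral convex cone is nonempty (contains $0$). The recession cone of a convex polyhedron $P$ is $0^+P=\{d: p+td\in P\ \forall p\in P,\ t\ge 0\}$. The recession mapping of $F$ is $G:\mathbb{R}^n\rightrightarrows\mathbb{R}^q$ with $\operatorname{gr}G=0^+\operatorname{gr}F$. The natural ordering cone of $F$ is $K=K_F=\{y\in\mathbb{R}^q : \exists x\in\mathbb{R}^n:\ y\in G(x),\ 0\in G(x)\}$. A polyhedral convex cone $C\subseteq\mathbb{R}^q$ is regular for $F$ if $\operatorname{lin}C\subseteq G(0)\subseteq C$, where $\operatorname{lin}C=C\cap(-C)$. Problem (P), given by $F$ and the ordering cone $C$: minimize $F(x)+C$ over $x\in\mathbb{R}^n$ with respect to $\supseteq$. Its upper image is $\mathcal{P}=C+\bigcup_{x\in\mathbb{R}^n}F(x)$.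 Solution concept. $\operatorname{conv}$ is the convex hull; $\operatorname{cone}Y$ is the smallest convex cone containing $Y$, with $\operatorname{cone}\emptyset=\{0\}$. - A pair $(\bar S,\hat S)$ of finite sets $\bar S\subseteq\operatorname{dom}F$, $\bar S\ne\emptyset$, $\hat S\subseteq\operatorname{dom}G\setminus\{0\}$ is a finite infimizer for (P) if $\mathcal{P}\subseteq C+\operatorname{conv}\bigcup_{x\in\bar S}F(x)+\operatorname{cone}\bigcup_{x\in\hat S}G(x)$. - $\bar x\in\operatorname{dom}F$ is a minimizing point for (P) if there is no $x\in\mathbb{R}^n$ with $F(x)+C\supsetneq F(\bar x)+C$. - A nonzero $\hat x\in\operatorname{dom}G$ is a minimizing direction for (P) if there is no $x\in\mathbb{R}^n$ with $G(x)+C\supsetneq G(\hat x)+C$. - A finite infimizer $(\bar S,\hat S)$ is a solution to (P) if all elements of $\bar S$ are minimizing points and all elements of $\hat S$ (if any) are minimizing directions. Vectorial relaxation. Define the polyhedral convex set-valued mapping $\hat F:\mathbb{R}^n\times\mathbb{R}^q\rightrightarrows\mathbb{R}^q$ by $\hat F(x,u)=\{u\}+G(0)$ if $u\in F(x)$ and $\hat F(x,u)=\emptyset$ otherwise. The vectorial relaxation (VR) of (P) is the problem $\min \hat F(x,u)+C$ s.t. $(x,u)\in\mathbb{R}^n\times\mathbb{R}^q$, i.e. the problem of the form (P) with objective mapping $\hat F$ (in place of $F$) and ordering cone $C$; its solutions are defined by the same solution concept, applied to $\hat F$, its recession mapping, and $C$. *)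

(* Defs.v *)
From mathcomp Require Import all_boot all_order all_algebra.
From mathcomp Require Import boolp classical_sets cardinality reals convex.

Set Implicit Arguments.
Unset Strict Implicit.
Unset Printing Implicit Defensive.

Import Order.TTheory GRing.Theory Num.Theory.

Local Open Scope classical_set_scope.
Local Open Scope ring_scope.

Definition addset (R : realType) (q : nat) (A B : set 'cV[R]_q) : set 'cV[R]_q :=
  [set a + b | a in A & b in B].

(* The empty set and the whole space are polyhedra. *)
Definition polyhedron (R : realType) (k : nat) (P : set 'cV[R]_k) : Prop :=
  exists (m : nat) (A : 'M[R]_(m, k)) (b : 'cV[R]_m),
    P = [set z | forall i : 'I_m, (A *m z) i 0 <= b i 0].

Definition convex_cone (R : realType) (k : nat) (C : set 'cV[R]_k) : Prop :=
  [/\ convex_set (C : set (convex_lmodType 'cV[R]_k)),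
      C 0 & forall (t : R) (y : 'cV[R]_k), 0 <= t -> C y -> C (t *: y)].

Definition polyhedral_convex_cone (R : realType) (k : nat)
    (C : set 'cV[R]_k) : Prop :=
  polyhedron C /\ convex_cone C.

Definition conv (R : realType) (k : nat) (Y : set 'cV[R]_k) : set 'cV[R]_k :=
  smallest (fun M => convex_set (M : set (convex_lmodType 'cV[R]_k))) Y.

Definition cone (R : realType) (k : nat) (Y : set 'cV[R]_k) : set 'cV[R]_k :=
  smallest (@convex_cone R k) Y.

Definition lin (R : realType) (k : nat) (C : set 'cV[R]_k) : set 'cV[R]_k :=
  C `&` [set - c | c in C].

(* The product of R^n and R^q is represented by R^(n + q), pairs being stacked
   with col_mx. *)
Definition gr (R : realType) (n q : nat) (F : 'cV[R]_n -> set 'cV[R]_q) :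
    set 'cV[R]_(n + q) :=
  [set z | F (usubmx z) (dsubmx z)].

Definition dom (R : realType) (n q : nat) (F : 'cV[R]_n -> set 'cV[R]_q) :
    set 'cV[R]_n :=
  [set x | F x !=set0].

Definition polyhedral_convex (R : realType) (n q : nat)
    (F : 'cV[R]_n -> set 'cV[R]_q) : Prop :=
  polyhedron (gr F).

Definition recession_cone (R : realType) (k : nat) (P : set 'cV[R]_k) :
    set 'cV[R]_k :=
  [set d | forall (p : 'cV[R]_k) (t : R), P p -> 0 <= t -> P (p + t *: d)].

Definition recession_map (R : realType) (n q : nat)
    (F : 'cV[R]_n -> set 'cV[R]_q) : 'cV[R]_n -> set 'cV[R]_q :=
  fun x => [set y | recession_cone (gr F) (col_mx x y)].

Definition natural_ordering_cone (R : realType) (n q : nat)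
    (F : 'cV[R]_n -> set 'cV[R]_q) : set 'cV[R]_q :=
  [set y | exists x : 'cV[R]_n, recession_map F x y /\ recession_map F x 0].

Definition regular (R : realType) (n q : nat) (F : 'cV[R]_n -> set 'cV[R]_q)
    (C : set 'cV[R]_q) : Prop :=
  lin C `<=` recession_map F 0 /\ recession_map F 0 `<=` C.

Definition upper_image (R : realType) (n q : nat)
    (F : 'cV[R]_n -> set 'cV[R]_q) (C : set 'cV[R]_q) : set 'cV[R]_q :=
  addset C (\bigcup_(x : 'cV[R]_n) F x).

Definition finite_infimizer (R : realType) (n q : nat)
    (F : 'cV[R]_n -> set 'cV[R]_q) (C : set 'cV[R]_q)
    (S T : set 'cV[R]_n) : Prop :=
  [/\ finite_set S /\ finite_set T,
      S `<=` dom F,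
      S !=set0,
      T `<=` dom (recession_map F) `\ 0 &
      upper_image F C `<=`
        addset (addset C (conv (\bigcup_(x in S) F x)))
               (cone (\bigcup_(x in T) recession_map F x))].

Definition minimizing_point (R : realType) (n q : nat)
    (F : 'cV[R]_n -> set 'cV[R]_q) (C : set 'cV[R]_q) (x0 : 'cV[R]_n) : Prop :=
  dom F x0 /\
  ~ exists x : 'cV[R]_n, addset (F x0) C `<` addset (F x) C.

Definition minimizing_direction (R : realType) (n q : nat)
    (F : 'cV[R]_n -> set 'cV[R]_q) (C : set 'cV[R]_q) (x0 : 'cV[R]_n) : Prop :=
  [/\ x0 != 0, dom (recession_map F) x0 &
      ~ exists x : 'cV[R]_n,
          addset (recession_map F x0) C `<` addset (recession_map F x) C].

Definition is_solution (R : realType) (n q : nat)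
    (F : 'cV[R]_n -> set 'cV[R]_q) (C : set 'cV[R]_q)
    (S T : set 'cV[R]_n) : Prop :=
  [/\ finite_infimizer F C S T,
      S `<=` minimizing_point F C &
      T `<=` minimizing_direction F C].

Definition has_solution (R : realType) (n q : nat)
    (F : 'cV[R]_n -> set 'cV[R]_q) (C : set 'cV[R]_q) : Prop :=
  exists S T : set 'cV[R]_n, is_solution F C S T.

(* For z = (x, u), the set {u} + G(0) if u lies in F(x), empty otherwise. *)
Definition vectorial_relaxation (R : realType) (n q : nat)
    (F : 'cV[R]_n -> set 'cV[R]_q) : 'cV[R]_(n + q) -> set 'cV[R]_q :=
  fun z => [set v | F (usubmx z) (dsubmx z) /\
                    addset [set dsubmx z] (recession_map F 0) v].

(* Main.v *)
(* Fourier-Motzkin elimination of one generator at a time (Weyl) yields Farkas'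
   lemma and Minkowski's theorem; homogenizing polyhedra, it also shows that
   bounded linear programs attain their maximum.

   For any polyhedral F with G(0) contained in C, problem (P) has a solution iff
   dom F is nonempty and: y, w in G(x) and -w in C imply y in C.
   Necessity: if x0 is minimizing, F(x0 + t x) + C contains F(x0) + C, hence
   equals it, so f0 + t y lies in F(x0) + C for all t >= 0, while facet normals
   of C are bounded above on F(x0).
   Sufficiency: maximizing the finitely many facet normals of gr(F + C) over all
   x' with F(x') + C containing F(x) + C gives a minimizing point dominating x
   (likewise for directions); the generators of the homogenized graph of F, once
   replaced by such minimizers, form a solution.

   The criterion applied to F and to its vectorial relaxation, where it reads
   "w in Im G and -w in C imply w in C", gives the theorem. *)

Require Import Defs.
From mathcomp Require Import all_boot all_order all_algebra.
From mathcomp Require Import boolp classical_sets reals.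
From mathcomp Require Import cardinality convex interval_inference ring lra.

Set Implicit Arguments.
Unset Strict Implicit.
Unset Printing Implicit Defensive.

Import Order.TTheory GRing.Theory Num.Theory.

Local Open Scope classical_set_scope.
Local Open Scope ring_scope.

(** * The inner product of column vectors *)

Section Dot.
Context {R : realFieldType}.
Implicit Types k l : nat.

Definition dot {k} (u v : 'cV[R]_k) : R := \sum_i u i 0 * v i 0.

Lemma dotC {k} (u v : 'cV[R]_k) : dot u v = dot v u.
Proof. by apply: eq_bigr => i _; rewrite mulrC. Qed.

Lemma dotDr {k} (u v w : 'cV[R]_k) : dot u (v + w) = dot u v + dot u w.
Proof. by rewrite -big_split; apply: eq_bigr => i _; rewrite mxE mulrDr. Qed.

Lemma dotZr {k} (u : 'cV[R]_k) a v : dot u (a *: v) = a * dot u v.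
Proof. by rewrite /dot big_distrr; apply: eq_bigr => i _; rewrite mxE /= mulrCA. Qed.

Lemma dotNr {k} (u v : 'cV[R]_k) : dot u (- v) = - dot u v.
Proof. by rewrite -scaleN1r dotZr mulN1r. Qed.

Lemma dot0r {k} (u : 'cV[R]_k) : dot u 0 = 0.
Proof. by rewrite -(scale0r u) dotZr mul0r. Qed.

Lemma dotDl {k} (u v w : 'cV[R]_k) : dot (u + v) w = dot u w + dot v w.
Proof. by rewrite !(dotC _ w) dotDr. Qed.

Lemma dotZl {k} a (u v : 'cV[R]_k) : dot (a *: u) v = a * dot u v.
Proof. by rewrite !(dotC _ v) dotZr. Qed.

Lemma dotNl {k} (u v : 'cV[R]_k) : dot (- u) v = - dot u v.
Proof. by rewrite !(dotC _ v) dotNr. Qed.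

Lemma dot0l {k} (u : 'cV[R]_k) : dot 0 u = 0.
Proof. by rewrite dotC dot0r. Qed.

Lemma dot_col_mx {k l} (a c : 'cV[R]_k) (b d : 'cV[R]_l) :
  dot (col_mx a b) (col_mx c d) = dot a c + dot b d.
Proof.
rewrite /dot big_split_ord /=.
by congr (_ + _); apply: eq_bigr => i _; rewrite ?col_mxEu ?col_mxEd.
Qed.

Lemma dot_scalar (a b : R) : dot (a%:M : 'cV_1) (b%:M : 'cV_1) = a * b.
Proof. by rewrite /dot big_ord1 !mxE !eqxx !mulr1n. Qed.

Lemma dot_delta {k} (i : 'I_k) (v : 'cV[R]_k) : dot (delta_mx i 0) v = v i 0.
Proof.
rewrite /dot (bigD1 i) //= mxE !eqxx mul1r big1 ?addr0 // => j ji.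
by rewrite mxE (negPf ji) mul0r.
Qed.

End Dot.

(** * Finitely generated and polyhedral cones *)

Section Cones.
Context {R : realFieldType}.
Implicit Types k l : nat.

Definition hcone {k} (B : seq 'cV[R]_k) (z : 'cV[R]_k) : Prop :=
  forall b, b \in B -> dot b z <= 0.

(** The recursion peels off one nonnegative multiplier at a time, which is the form that eliminating
    one generator at a time consumes. *)
Fixpoint gcone {k} (G : seq 'cV[R]_k) (z : 'cV[R]_k) : Prop :=
  if G is g :: G' then exists2 t, 0 <= t & gcone G' (z - t *: g) else z = 0.

Lemma gcone_elim {k} (G : seq 'cV[R]_k) (M : 'cV[R]_k -> Prop) :
  M 0 -> (forall u v, M u -> M v -> M (u + v)) ->
  (forall t u, 0 <= t -> M u -> M (t *: u)) ->
  (forall g, g \in G -> M g) -> forall z, gcone G z -> M z.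
Proof.
move=> M0 MD MZ; elim: G => [|g G IH] MG z /=; first by move=> ->.
move=> [t t0 zG]; rewrite -(subrK (t *: g) z); apply: MD.
  by apply: IH zG => h hG; apply: MG; rewrite inE hG orbT.
by apply: MZ => //; apply: MG; rewrite inE eqxx.
Qed.

Lemma gcone0 {k} (G : seq 'cV[R]_k) : gcone G 0.
Proof. by elim: G => [//|g G IH]; exists 0; rewrite ?scale0r ?subr0. Qed.

Lemma mem_gcone {k} (G : seq 'cV[R]_k) g : g \in G -> gcone G g.
Proof.
elim: G => [//|h G IH]; rewrite inE => /orP[/eqP ->|gG] /=.
  by exists 1; rewrite ?ler01 // scale1r subrr; apply: gcone0.
by exists 0; rewrite ?scale0r ?subr0 //; apply: IH.
Qed.

Lemma gcone_dot_le0 {k} (G : seq 'cV[R]_k) b :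
  (forall g, g \in G -> dot b g <= 0) -> forall z, gcone G z -> dot b z <= 0.
Proof.
move=> bG; apply: gcone_elim => //; first by rewrite dot0r.
- by move=> u v u0 v0; rewrite dotDr; lra.
- by move=> t u t0 u0; rewrite dotZr mulr_ge0_le0.
Qed.

Lemma gcone_cat {k} (G H : seq 'cV[R]_k) z :
  gcone (G ++ H) z <-> exists u v, [/\ gcone G u, gcone H v & z = u + v].
Proof.
elim: G z => [|g G IH] z /=.
  split=> [zH|[u [v [-> vH ->]]]]; last by rewrite add0r.
  by exists 0, z; rewrite add0r.
split=> [[t t0 /IH[u [v [uG vH E]]]]|[u [v [[t t0 uG] vH ->]]]].
  exists (u + t *: g), v; split=> //; first by exists t; rewrite ?addrK.
  by rewrite addrAC -E subrK.
by exists t => //; apply/IH; exists (u - t *: g), v; rewrite addrAC.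
Qed.

Lemma gcone_map {k l} (f : {linear 'cV[R]_k -> 'cV[R]_l}) G w :
  gcone (map f G) w <-> exists2 z, gcone G z & w = f z.
Proof.
elim: G w => [|g G IH] w /=.
  split=> [->|[z -> ->]]; last by rewrite linear0.
  by exists 0; rewrite ?linear0.
split=> [[t t0 /IH[z zG E]]|[z [t t0 zG] ->]].
  exists (z + t *: g); first by exists t => //; rewrite addrK.
  by rewrite linearD (linearZ_LR f) -E subrK.
by exists t => //; apply/IH; exists (z - t *: g) => //; rewrite linearB (linearZ_LR f).
Qed.

Lemma exists_between (L U : seq R) :
  (forall (l u : R), l \in L -> u \in U -> l <= u) ->
  exists t, (forall l : R, l \in L -> l <= t) /\ (forall u, u \in U -> t <= u).
Proof.
elim: L => [|l L IH] LU.
  elim: U {LU} => [|u U [t [_ tU]]]; first by exists 0.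
  exists (Num.min t u); split=> // v; rewrite inE ge_min.
  by case/orP=> [/eqP ->|/tU ->]; rewrite ?lexx ?orbT.
have [|t [Lt tU]] := IH; first by move=> l' u l'L; apply: LU; rewrite inE l'L orbT.
exists (Num.max l t); split=> [m|u uU].
  by rewrite inE le_max => /orP[/eqP ->|/Lt ->]; rewrite ?lexx ?orbT.
by rewrite ge_max tU // LU ?inE ?eqxx.
Qed.

(* One step of Fourier-Motzkin elimination, applied to the multiplier of [g]:
   a pair of constraints with opposite signs on [g] is combined so that [g]
   cancels. *)
Lemma weyl_step {k} (B : seq 'cV[R]_k) g :
  exists B', forall z, hcone B' z <-> exists2 t, 0 <= t & hcone B (z - t *: g).
Proof.
pose N := [seq b <- B | dot b g <= 0].
pose P := [seq b <- B | 0 < dot b g].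
exists (N ++ [seq dot b g *: c - dot c g *: b | b <- P, c <- N]) => z; split.
  move=> zB.
  have zN b : b \in B -> dot b g <= 0 -> dot b z <= 0.
    by move=> bB bg; apply: zB; rewrite mem_cat mem_filter bg bB.
  have zPN b c : b \in B -> c \in B -> 0 < dot b g -> dot c g <= 0 ->
      dot b g * dot c z <= dot c g * dot b z.
    move=> bB cB bg cg; rewrite -subr_le0.
    have := zB (dot b g *: c - dot c g *: b).
    rewrite dotDl dotNl !dotZl; apply; rewrite mem_cat; apply/orP; right.
    by apply/allpairsP; exists (b, c); rewrite !mem_filter /= bg bB cg cB.
  pose Q := [seq b <- B | dot b g < 0].
  (* Normals positive on [g] bound the multiplier [t] from below, normals negative on [g] bound it
     from above; the extra lower bound [0] encodes [0 <= t]. *)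
  have [l u|t [Lt tU]] := @exists_between (0 :: [seq dot b z / dot b g | b <- P])
      [seq dot c z / dot c g | c <- Q].
    move=> lP /mapP[c]; rewrite mem_filter => /andP[cg cB] ->.
    move: lP; rewrite inE => /orP[/eqP ->|/mapP[b]].
      by rewrite -mulrNN -invrN divr_ge0 ?oppr_ge0 ?zN // ltW.
    rewrite mem_filter => /andP[bg bB] ->.
    rewrite ler_pdivrMr // mulrAC ler_ndivlMr // mulrC.
    by rewrite [leRHS]mulrC zPN // ltW.
  exists t; first by rewrite Lt ?inE ?eqxx.
  move=> b bB; rewrite dotDr dotNr dotZr subr_le0.
  have [bg|bg|bg] := ltgtP (dot b g) 0.
  - rewrite -ler_ndivlMr //; apply: tU; apply/mapP; exists b => //.
    by rewrite mem_filter bg.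
  - rewrite -ler_pdivrMr //; apply: Lt; rewrite inE; apply/orP; right.
    by apply/mapP; exists b => //; rewrite mem_filter bg.
  - by rewrite bg mulr0 zN // bg.
move=> [t t0 zB] b; rewrite mem_cat => /orP[|/allpairsP[[c d] /=]].
  rewrite mem_filter => /andP[bg bB].
  have := zB _ bB; rewrite dotDr dotNr dotZr; have := mulr_ge0_le0 t0 bg; lra.
rewrite !mem_filter => -[/andP[cg cB] /andP[dg dB] ->].
have := zB _ cB; have := zB _ dB; rewrite dotDl dotNl !dotZl !dotDr !dotNr !dotZr.
move=> hd hc; move: (dot c g) (dot d g) (dot c z) (dot d z) cg dg hd hc => p m x y.
nra.
Qed.

Theorem weyl {k} (G : seq 'cV[R]_k) : exists B, forall z, gcone G z <-> hcone B z.
Proof.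
elim: G => [|g G [B GB]].
  (* Without generators the cone is the origin, cut out by the coordinate vectors and their
     negatives. *)
  exists ([seq delta_mx i 0 | i : 'I_k] ++ [seq - delta_mx i 0 | i : 'I_k]) => z.
  split=> [-> b _|zB]; first by rewrite dot0r.
  apply/matrixP => i j; rewrite ord1 mxE; apply/eqP; rewrite eq_le; apply/andP.
  split; last rewrite -oppr_le0; rewrite -dot_delta -?dotNl; apply: zB;
    rewrite mem_cat; apply/orP; [left|right];
    by apply/mapP; exists i; rewrite ?mem_enum.
have [B' hB'] := weyl_step B g; exists B' => z; split=> /=.
  by move=> [t t0 /GB zB]; apply/hB'; exists t.
by move=> /hB'[t t0 /GB zG]; exists t.
Qed.

(** Each normal of the Weyl description of [gcone A] is nonpositive on [A], so it lies in [hcone A],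
    where [b] is nonpositive by assumption. *)
Theorem farkas {k} (A : seq 'cV[R]_k) b :
  (forall z, hcone A z -> dot b z <= 0) -> gcone A b.
Proof.
have [B AB] := weyl A => hb; apply/AB => c cB; rewrite dotC; apply: hb => a aA.
by rewrite dotC; move/mem_gcone: aA => /AB; apply.
Qed.

(** By duality: the normals describing [gcone A] generate the polar cone [hcone A]. *)
Theorem minkowski {k} (A : seq 'cV[R]_k) :
  exists G, forall z, hcone A z <-> gcone G z.
Proof.
have [B AB] := weyl A; exists B => z; split=> [zA|].
  by apply: farkas => y /AB; apply: gcone_dot_le0 => a /zA; rewrite dotC.
move=> + a aA; apply: gcone_dot_le0 => b bB; rewrite dotC.
by move/mem_gcone: aA => /AB; apply.
Qed.

End Cones.

(** * Polyhedra, their homogenization, and attainment in linear programming *)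

Section Polyhedra.
Context {R : realFieldType} {k : nat}.
Implicit Types (s : seq ('cV[R]_k * R)) (z : 'cV[R]_k) (t : R).

Definition hpoly s z : Prop := forall c, c \in s -> dot c.1 z <= c.2.

Definition hrec s z : Prop := forall c, c \in s -> dot c.1 z <= 0.

Definition homvec z t : 'cV[R]_(k + 1) := col_mx z t%:M.

Lemma dot_hom u a z t : dot (homvec u a) (homvec z t) = dot u z + a * t.
Proof. by rewrite dot_col_mx dot_scalar. Qed.

Lemma homE (w : 'cV[R]_(k + 1)) : w = homvec (usubmx w) (dsubmx w 0 0).
Proof. by rewrite /homvec -[in LHS](vsubmxK w) [dsubmx w in LHS]mx11_scalar. Qed.

Lemma homD z z' t t' : homvec z t + homvec z' t' = homvec (z + z') (t + t').
Proof. by rewrite /homvec add_col_mx raddfD. Qed.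

Lemma homK z t : usubmx (homvec z t) = z.
Proof. exact: col_mxKu. Qed.

Lemma hom_last z t : dsubmx (homvec z t) 0 0 = t.
Proof. by rewrite col_mxKd mxE. Qed.

(** The cone over the polyhedron. The first normal keeps the height nonnegative; height 1 gives back
    the polyhedron and height 0 its homogeneous system. *)
Definition homog s : seq 'cV[R]_(k + 1) :=
  homvec 0 (-1) :: [seq homvec c.1 (- c.2) | c <- s].

Lemma homogP s z t :
  hcone (homog s) (homvec z t) <->
  0 <= t /\ (forall c, c \in s -> dot c.1 z <= c.2 * t).
Proof.
split=> [H|[t0 H] w].
  split=> [|c cs].
    by have := H (homvec 0 (-1)) (mem_head _ _); rewrite dot_hom dot0l; lra.
  have : homvec c.1 (- c.2) \in homog s.
    by rewrite inE; apply/orP; right; apply/mapP; exists c.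
  by move/H; rewrite dot_hom; lra.
rewrite inE => /orP[/eqP ->|/mapP[c /H + ->]]; rewrite dot_hom ?dot0l; lra.
Qed.

Lemma homog1 s z : hcone (homog s) (homvec z 1) <-> hpoly s z.
Proof.
rewrite homogP; split=> [[_ H] c /H|H]; first by rewrite mulr1.
by split; [lra|move=> c /H; rewrite mulr1].
Qed.

Lemma homog0 s z : hcone (homog s) (homvec z 0) <-> hrec s z.
Proof.
rewrite homogP; split=> [[_ H] c /H|H]; first by rewrite mulr0.
by split=> // c /H; rewrite mulr0.
Qed.

Lemma homog_pos s z t :
  0 < t -> hcone (homog s) (homvec z t) -> hpoly s (t^-1 *: z).
Proof.
move=> t0 /homogP[_ H] c /H.
by rewrite dotZr ler_pdivrMl // mulrC.
Qed.

Lemma seq_maximum {T : eqType} (r : seq T) (f : T -> R) : r != [::] ->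
  exists2 x, x \in r & forall y, y \in r -> f y <= f x.
Proof.
elim: r => [//|x [|y r] IH] _.
  by exists x; rewrite ?mem_head // => z; rewrite inE => /eqP ->.
have [z zr zmax] := IH isT; have [xz|zx] := leP (f x) (f z).
  by exists z => [|w]; rewrite inE ?zr ?orbT // => /orP[/eqP -> //|/zmax].
exists x => [|w]; rewrite ?mem_head // inE => /orP[/eqP -> //|/zmax wz].
exact: le_trans wz (ltW zx).
Qed.

(** Generators of the homogenized cone of positive height are multiples of feasible points, and
    those of height 0 are directions along which [b] does not increase. The best generator of
    positive height is therefore optimal. *)
Theorem lp_attained s b : (exists z, hpoly s z) ->
  (forall z, hrec s z -> dot b z <= 0) ->
  exists2 z, hpoly s z & forall z', hpoly s z' -> dot b z' <= dot b z.
Proof.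
move=> [z0 z0s] bd.
have [G hG] := minkowski (homog s).
pose last1 := (fun g : 'cV[R]_(k + 1) => dsubmx g 0 0).
pose r := [seq g <- G | 0 < last1 g].
pose val g := dot b (usubmx g) / last1 g.
have Gpos g : g \in G -> 0 <= last1 g.
  move=> /mem_gcone /hG; rewrite {1}[g]homE => /homogP[]; exact.
have r0 : r != [::].
  apply/negP => /eqP r0.
  (* If no generator had positive height, the height would be nonpositive on the whole cone, yet it
     is 1 at the lift of [z0]. *)
  have: dot (homvec 0 1) (homvec z0 1) <= 0.
    apply: (@gcone_dot_le0 _ _ G); last exact/hG/homog1.
    move=> g gG; rewrite [g]homE dot_hom dot0l mul1r add0r leNgt.
    apply/negP => g0; suff: g \in r by rewrite r0.
    by rewrite mem_filter g0 gG.
  by rewrite dot_hom dot0l; lra.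
have [g] := seq_maximum val r0.
rewrite mem_filter => /andP[g0 gG] gmax.
exists ((last1 g)^-1 *: usubmx g).
  by apply: homog_pos => //; rewrite -homE; apply/hG/mem_gcone.
move=> z' z's; rewrite dotZr mulrC -/(val g).
(* The linear form subtracting [val g] times the height from [b] is nonpositive on all generators,
   hence at the lift of [z']. *)
have: dot (homvec b (- val g)) (homvec z' 1) <= 0.
  apply: (@gcone_dot_le0 _ _ G); last exact/hG/homog1.
  move=> h hG'; rewrite [h]homE dot_hom -/(last1 h).
  have [h0|h0] := ltP 0 (last1 h).
    have := gmax h; rewrite mem_filter h0 hG' => /(_ isT).
    by rewrite {1}/val ler_pdivrMr //; lra.
  have E : last1 h = 0 by apply/le_anti; rewrite h0 Gpos.
  rewrite E mulr0 addr0; apply: bd; apply/homog0.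
  by rewrite -E -homE; apply/hG/mem_gcone.
by rewrite dot_hom; lra.
Qed.

End Polyhedra.

(** * Maximal slices of a polyhedron *)

Section Slices.
Context {R : realFieldType} {n q : nat}.
Implicit Types (x d : 'cV[R]_n) (y e : 'cV[R]_q).

Lemma dot_split (w : 'cV[R]_(n + q)) x y :
  dot w (col_mx x y) = dot (usubmx w) x + dot (dsubmx w) y.
Proof. by rewrite -[in LHS](vsubmxK w) dot_col_mx. Qed.

Variable s : seq ('cV[R]_(n + q) * R).

Definition slice x y : Prop := hpoly s (col_mx x y).

(** Fixing [x] only changes right-hand sides, so the recession directions of a slice are the
    vertical ones of [s]. *)
Lemma slice_support x y0 b : slice x y0 ->
  (forall e, hrec s (col_mx 0 e) -> dot b e <= 0) ->
  exists2 y, slice x y & forall y', slice x y' -> dot b y' <= dot b y.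
Proof.
move=> xy0 bd.
pose f (a : 'cV[R]_(n + q) * R) := (dsubmx a.1, a.2 - dot (usubmx a.1) x).
have rP y : hpoly (map f s) y <-> slice x y.
  split=> [H a aS|H _ /mapP[a /H + ->] /=]; last by rewrite dot_split; lra.
  by have /H /= := map_f f aS; rewrite dot_split; lra.
have [|e re|y /rP xy ymax] := @lp_attained _ _ (map f s) b.
- by exists y0; apply/rP.
- apply: bd => a aS; have /re /= := map_f f aS.
  by rewrite dot_split dot0r add0r.
- by exists y => // y' /rP; apply: ymax.
Qed.

(** This makes the linear programs over enlarged slices bounded. For the graph of F + C it follows
    from [recession_bounded]. *)
Hypothesis rec_vertical : forall d e,
  hrec s (col_mx d 0) -> hrec s (col_mx d e) -> hrec s (col_mx 0 e).

(** Containing [slice x] is a finite linear condition on [x']: each constraint need only be checked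
    at a point of [slice x] maximizing its normal. What remains is a single linear program in [x']
    and [y]. *)
Lemma slice_maximize x y0 c : slice x y0 -> c \in s ->
  exists x' y, [/\ slice x `<=` slice x', slice x' y &
    forall x'' y'', slice x `<=` slice x'' -> slice x'' y'' ->
      dot (dsubmx c.1) y'' <= dot (dsubmx c.1) y].
Proof.
move=> xy0 cs.
have /choice[Y YP] : forall a, exists y, a \in s -> slice x y /\
    forall y', slice x y' -> dot (dsubmx a.1) y' <= dot (dsubmx a.1) y.
  move=> a; have [aS|aS] := boolP (a \in s); last by exists 0.
  have [e /(_ a aS)|y xy ymax] := @slice_support x y0 (dsubmx a.1) xy0.
    by rewrite dot_split dot0r add0r.
  by exists y.
(* The constraint [a] with its [y]-part frozen at the worst point [Y a], leaving a condition on [x']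
   alone. *)
pose f (a : 'cV[R]_(n + q) * R) :=
  (col_mx (usubmx a.1) (0 : 'cV_q), a.2 - dot (dsubmx a.1) (Y a)).
pose r := s ++ [seq f a | a <- s].
have rP x' y' : hpoly r (col_mx x' y') <-> slice x `<=` slice x' /\ slice x' y'.
  split=> [H|[xx' x'y'] a].
    split=> [y xy a aS|a aS]; last by apply: H; rewrite mem_cat aS.
    have /H : f a \in r by rewrite mem_cat map_f ?orbT.
    have [_ /(_ _ xy)] := YP a aS.
    by rewrite !dot_split /= !col_mxKu col_mxKd dot0l; lra.
  rewrite mem_cat => /orP[/x'y' //|/mapP[b bS ->]].
  have [/xx' /(_ _ bS)] := YP b bS.
  by rewrite !dot_split /= !col_mxKu col_mxKd dot0l; lra.
have [|z rz|z rz zmax] := @lp_attained _ _ r (col_mx 0 (dsubmx c.1)).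
- by exists (col_mx x y0); apply/rP; split.
- rewrite -(vsubmxK z) in rz *; rewrite dot_col_mx dot0l add0r.
  have /(_ _ cs) : hrec s (col_mx 0 (dsubmx z)).
    apply: (@rec_vertical (usubmx z)) => a aS; last first.
      by apply: rz; rewrite mem_cat aS.
    have /rz : f a \in r by rewrite mem_cat map_f ?orbT.
    by rewrite !dot_split /= !col_mxKu col_mxKd dot0l dot0r.
  by rewrite dot_split dot0r add0r.
- rewrite -(vsubmxK z) in rz zmax; have /rP[xx' x'y] := rz.
  exists (usubmx z), (dsubmx z); split=> // x'' y'' xx'' x''y''.
  have := zmax (col_mx x'' y''); rewrite !dot_col_mx !dot0l !add0r; apply.
  exact/rP.
Qed.

(* Maximizing the facet normals of the slices one after the other: enlarging the
   slice can only increase the maxima already reached. *)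
Lemma slice_maximize_all (l : seq ('cV[R]_(n + q) * R)) x y0 : slice x y0 ->
  {subset l <= s} ->
  exists x', slice x `<=` slice x' /\
    forall c x'' y'', c \in l -> slice x' `<=` slice x'' -> slice x'' y'' ->
      exists2 y, slice x' y & dot (dsubmx c.1) y'' <= dot (dsubmx c.1) y.
Proof.
move=> xy0; elim: l => [|c l IH] ls; first by exists x; split.
have [|x1 [xx1 x1P]] := IH; first by move=> a al; apply: ls; rewrite inE al orbT.
have [x2 [y [x12 x2y x2P]]] :=
  slice_maximize (xx1 _ xy0) (ls c (mem_head _ _)).
exists x2; split=> [|a x3 y3]; first exact: subset_trans x12.
rewrite inE => /orP[/eqP ->|al] x23 x3y3.
  by exists y => //; apply: (x2P x3) => //; apply: subset_trans x23.
have [y' x1y' ay'] := x1P a x3 y3 al (subset_trans x12 x23) x3y3.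
by exists y' => //; apply: x12.
Qed.

(** When no larger slice raises the maximum of any normal, every point of a larger slice satisfies
    each constraint already at [x']. *)
Theorem slice_maximal x y0 : slice x y0 ->
  exists x', slice x `<=` slice x' /\
    forall x'', slice x' `<=` slice x'' -> slice x'' `<=` slice x'.
Proof.
move=> xy0; have [x' [xx' x'P]] := slice_maximize_all xy0 (fun _ cs => cs).
exists x'; split=> // x'' x'x'' y'' x''y'' c cs.
have [y /(_ _ cs)] := x'P c x'' y'' cs x'x'' x''y''.
by rewrite !dot_split; lra.
Qed.

End Slices.

(** * Convex hulls and cones; finite systems of inequalities for polyhedra, cones and recession
    cones *)

Section Sets.
Context {R : realType}.

Lemma addsetP {q : nat} (A B : set 'cV[R]_q) y :
  addset A B y <-> exists2 b, B b & A (y - b).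
Proof.
split=> [[a Aa [b Bb <-]]|[b Bb Ayb]]; first by exists b; rewrite ?addrK.
by exists (y - b) => //; exists b; rewrite ?subrK.
Qed.

Lemma convex_setD {k : nat} (A : set 'cV[R]_k) (a b : R) u v :
  convex_set (A : set (convex_lmodType 'cV[R]_k)) ->
  0 <= a -> 0 <= b -> a + b = 1 -> A u -> A v -> A (a *: u + b *: v).
Proof.
move=> cA a0 b0 ab Au Av.
have a1 : a <= 1 by lra.
have := cA u v (Itv01 a0 a1); rewrite !inE => /(_ Au Av).
suff -> : conv (Itv01 a0 a1) (u : convex_lmodType 'cV[R]_k) v = a *: u + b *: v by [].
by rewrite /conv /= /unstable.onem -ab [a + b]addrC addrK.
Qed.

Lemma convex_coneD {k : nat} (A : set 'cV[R]_k) u v :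
  convex_cone A -> A u -> A v -> A (u + v).
Proof.
move=> [cA _ AZ] Au Av.
have -> : u + v = 2 *: (2^-1 *: u + 2^-1 *: v).
  by rewrite scalerDr !scalerA divff ?scale1r // pnatr_eq0.
by apply: AZ; [lra|apply: convex_setD => //; lra].
Qed.

Lemma subset_cone {k : nat} (Y : set 'cV[R]_k) : Y `<=` cone Y.
Proof. exact: sub_gen_smallest. Qed.

Lemma cone_zero {k : nat} (Y : set 'cV[R]_k) : cone Y 0.
Proof. by move=> A [[]]. Qed.

Lemma coneD {k : nat} (Y : set 'cV[R]_k) u v :
  cone Y u -> cone Y v -> cone Y (u + v).
Proof.
move=> Yu Yv A AY; have [cA _] := AY.
by apply: convex_coneD => //; [apply: Yu|apply: Yv].
Qed.

Lemma coneZ {k : nat} (Y : set 'cV[R]_k) (t : R) u :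
  0 <= t -> cone Y u -> cone Y (t *: u).
Proof.
move=> t0 Yu A AY; have [[_ _ AZ] _] := AY.
by apply: AZ => //; apply: Yu.
Qed.

Lemma subset_conv {k : nat} (Y : set 'cV[R]_k) : Y `<=` Defs.conv Y.
Proof. exact: sub_gen_smallest. Qed.

Lemma convD {k : nat} (Y : set 'cV[R]_k) (a b : R) u v :
  0 <= a -> 0 <= b -> a + b = 1 -> Defs.conv Y u -> Defs.conv Y v ->
  Defs.conv Y (a *: u + b *: v).
Proof.
move=> a0 b0 ab Yu Yv A AY; have [cA _] := AY.
by apply: convex_setD => //; [apply: Yu|apply: Yv].
Qed.

Lemma le0_of_ray (a b c : R) : (forall t, 0 <= t -> a + t * b <= c) -> b <= 0.
Proof.
move=> H; rewrite leNgt; apply/negP => b0.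
have := H 0 (lexx _); rewrite mul0r addr0 => ac.
(* At this [t] the left-hand side would equal [c + 1]. *)
have := H ((c - a + 1) / b); rewrite divfK ?gt_eqF //.
by move/(_ (divr_ge0 _ (ltW b0))); lra.
Qed.

Lemma polyhedron_hpoly {k : nat} (P : set 'cV[R]_k) :
  polyhedron P -> exists s, forall z, P z <-> hpoly s z.
Proof.
move=> [m [A [b ->]]]; exists [seq ((row i A)^T, b i 0) | i : 'I_m] => z.
have E i : dot (row i A)^T z = (A *m z) i 0.
  by rewrite mxE; apply: eq_bigr => j _; rewrite !mxE.
split=> /= [H _ /mapP[i _ ->]|H i] /=; first by rewrite E.
rewrite -E; apply: (H ((row i A)^T, b i 0)).
by apply/mapP; exists i; rewrite ?mem_enum.
Qed.

(** Right-hand sides may be replaced by 0: a linear form bounded above on a ray from the origin is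
    nonpositive there, and since the cone contains 0 the original right-hand sides are
    nonnegative. *)
Lemma polyhedral_convex_cone_hcone {k : nat} (C : set 'cV[R]_k) :
  polyhedral_convex_cone C -> exists B, forall y, C y <-> hcone B y.
Proof.
move=> [/polyhedron_hpoly[s sP] [_ C0 CZ]]; exists (map fst s) => y.
split=> [Cy _ /mapP[c cs ->]|H].
  apply: (@le0_of_ray 0 _ c.2) => t t0.
  by rewrite add0r -dotZr; apply: (sP _).1 cs; apply: CZ.
apply/sP => c cs; apply: le_trans (H c.1 (map_f _ cs)) _.
by have := (sP 0).1 C0 c cs; rewrite dot0r.
Qed.

(** Nonemptiness matters: every direction is vacuously a recession direction of the empty set. *)
Lemma recession_coneP {k : nat} (P : set 'cV[R]_k) s d :
  (forall z, P z <-> hpoly s z) -> P !=set0 ->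
  recession_cone P d <-> hrec s d.
Proof.
move=> sP [p Pp]; split=> [H c cs|H z t /sP Pz t0].
  apply: (@le0_of_ray (dot c.1 p) _ c.2) => t t0.
  by rewrite -dotZr -dotDr; apply: (sP _).1 cs; apply: H.
apply/sP => c cs; rewrite dotDr dotZr.
by have := Pz c cs; have := mulr_ge0_le0 t0 (H c cs); lra.
Qed.

End Sets.

(** The sum of two finitely generated cones is generated by the joint list, which Weyl's theorem
    turns back into inequalities. One system serves all heights, hence both F + C and G + C. *)
Lemma hcone_homog_addset {R : realFieldType} {n q : nat}
    (s : seq ('cV[R]_(n + q) * R)) (B : seq 'cV[R]_q) :
  exists B', forall (x : 'cV[R]_n) y t, hcone B' (homvec (col_mx x y) t) <->
    exists2 c, hcone B c & hcone (homog s) (homvec (col_mx x (y - c)) t).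
Proof.
have [G1 G1P] := minkowski (homog s); have [G2 G2P] := minkowski B.
(* [M] places [c] in the [y]-block, with zero [x]-block and zero height. *)
pose M : 'M[R]_(n + q + 1, q) := col_mx (col_mx 0 1%:M) 0.
have ME c : M *m c = homvec (col_mx 0 c) 0.
  by rewrite !mul_col_mx !mul0mx mul1mx /homvec raddf0.
have [B' B'P] := weyl (G1 ++ map (mulmx M) G2); exists B' => x y t.
rewrite -B'P gcone_cat; split=> [[u [v [/G1P uG /gcone_map[c /G2P cB ->] E]]]|].
  exists c => //; suff -> : homvec (col_mx x (y - c)) t = u by [].
  apply: (addIr (M *m c)); rewrite -E ME homD add_col_mx.
  by rewrite !addr0 subrK.
move=> [c cB zB]; exists (homvec (col_mx x (y - c)) t), (M *m c).
split; [exact/G1P| |by rewrite ME homD add_col_mx !addr0 subrK].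
by apply/gcone_map; exists c => //; apply/G2P.
Qed.

(** * Existence of solutions *)

Section Existence.
Context {R : realType} {n q : nat}.
Variables (F : 'cV[R]_n -> set 'cV[R]_q) (C : set 'cV[R]_q).
Variables (s : seq ('cV[R]_(n + q) * R)) (B : seq 'cV[R]_q).
Hypothesis FP : forall z, gr F z <-> hpoly s z.
Hypothesis CP : forall y, C y <-> hcone B y.
Hypothesis G0C : recession_map F 0 `<=` C.

Local Notation G := (recession_map F).

(** Having [- w] in [C] for some [w] in G(x) means that 0 lies in G(x) + C. The condition thus says
    that the natural ordering cone of F + C lies in [C]. *)
Definition recession_bounded : Prop :=
  forall x y w, G x y -> G x w -> C (- w) -> C y.

Let C0 : C 0.
Proof. by apply/CP => b _; rewrite dot0r. Qed.

Let CD u v : C u -> C v -> C (u + v).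
Proof.
move=> /CP Cu /CP Cv; apply/CP => b bB; rewrite dotDr.
by have := Cu b bB; have := Cv b bB; lra.
Qed.

Let CZ (t : R) u : 0 <= t -> C u -> C (t *: u).
Proof.
by move=> t0 /CP Cu; apply/CP => b /Cu; rewrite dotZr; apply: mulr_ge0_le0.
Qed.

Lemma gr_slice x y : F x y <-> slice s x y.
Proof. by rewrite /slice -FP /gr /= col_mxKu col_mxKd. Qed.

Lemma gr_nonempty : dom F !=set0 -> gr F !=set0.
Proof. by move=> [x [y /gr_slice xy]]; exists (col_mx x y); apply/FP. Qed.

Lemma recession_mapP x y : dom F !=set0 -> G x y <-> hrec s (col_mx x y).
Proof. by move=> /gr_nonempty; apply: recession_coneP. Qed.

Lemma recession_map_ray x y d e (t : R) :
  F x y -> G d e -> 0 <= t -> F (x + t *: d) (y + t *: e).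
Proof.
move=> /gr_slice xy de t0; apply/gr_slice.
have := de _ t ((FP _).2 xy) t0.
by rewrite scale_col_mx add_col_mx => /FP.
Qed.

Lemma minimizing_point_recession_bounded x0 :
  minimizing_point F C x0 -> recession_bounded.
Proof.
move=> [[f0 Ff0] x0min] x y w Gy Gw Cw; apply/CP => b bB.
have dF : dom F !=set0 by exists x0, f0.
have ray t : 0 <= t -> addset (F x0) C (f0 + t *: y).
  (* Moving by [t *: x] loses nothing: the value shifts by [t *: w], and [t *: - w] in [C]
     compensates. Minimality of [x0] then yields the reverse inclusion. *)
  move=> t0; have : addset (F x0) C `<=` addset (F (x0 + t *: x)) C.
    move=> z /addsetP[c Cc Fz]; apply/addsetP; exists (c + t *: - w).
      by apply: CD => //; apply: CZ.
    rewrite opprD addrA scalerN opprK; exact: recession_map_ray.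
  move=> sub; have /not_andP[//|] :
      ~ (addset (F x0) C `<=` addset (F (x0 + t *: x)) C /\
         ~ (addset (F (x0 + t *: x)) C `<=` addset (F x0) C)).
    by move=> H; apply: x0min; exists (x0 + t *: x).
  move=> /contrapT; apply; apply/addsetP; exists 0 => //.
  by rewrite subr0; apply: recession_map_ray.
have [e /(recession_mapP _ _ dF)/G0C/CP Ce|f _ fmax] :=
  @slice_support _ _ _ s x0 f0 b ((gr_slice _ _).1 Ff0); first exact: Ce.
apply: (@le0_of_ray _ (dot b f0) _ (dot b f)) => t t0.
have /addsetP[c /CP Cc /gr_slice/fmax] := ray t t0.
by rewrite !dotDr dotNr dotZr; have := Cc b bB; lra.
Qed.

Hypothesis dF : dom F !=set0.
Hypothesis bounded : recession_bounded.

(* [E] is [F] for [t = 1] and the recession mapping of [F] for [t = 0]. *)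
Lemma dominating_minimizer (t : R) (E : 'cV[R]_n -> set 'cV[R]_q) x :
  (forall x y, E x y <-> hcone (homog s) (homvec (col_mx x y) t)) ->
  E x !=set0 ->
  exists x', [/\ E x' !=set0, addset (E x) C `<=` addset (E x') C &
    ~ exists x'', addset (E x') C `<` addset (E x'') C].
Proof.
move=> EP [y Exy]; have [B' B'P] := hcone_homog_addset s B.
(* Fixing the height at [t] moves its coefficient to the right-hand side, so [r] describes the graph
   of E + C. *)
pose r := [seq (usubmx b, - (dsubmx b 0 0 * t)) | b <- B'].
have rP z : hpoly r z <-> hcone B' (homvec z t).
  split=> [H b bB|H _ /mapP[b /H + ->] /=].
    have /H /= : (usubmx b, - (dsubmx b 0 0 * t)) \in r by apply/mapP; exists b.
    by rewrite [X in dot X (homvec _ _)]homE dot_hom; lra.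
  by rewrite [X in dot X (homvec _ _)]homE dot_hom; lra.
have r0P z : hrec r z <-> hcone B' (homvec z 0).
  split=> [H b bB|H _ /mapP[b /H + ->] /=].
    have /H /= : (usubmx b, - (dsubmx b 0 0 * t)) \in r by apply/mapP; exists b.
    by rewrite [X in dot X (homvec _ _)]homE dot_hom; lra.
  by rewrite [X in dot X (homvec _ _)]homE dot_hom; lra.
have sliceP u : slice r u = addset (E u) C.
  apply/seteqP; split=> v.
    by move=> /rP/B'P[c cB /EP Ec]; apply/addsetP; exists c => //; apply/CP.
  by move=> /addsetP[c /CP cB /EP Ec]; apply/rP/B'P; exists c.
have recP d e : hrec r (col_mx d e) <-> exists2 c, C c & G d (e - c).
  rewrite r0P B'P; split=> -[c cB dc]; exists c; try exact/CP.
    by apply/recession_mapP => //; apply/homog0.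
  by apply/homog0/recession_mapP.
(* With [- c] and [e - c'] in G(d), [bounded] puts [e - c'] in [C], hence [e] too; then [e] is the
   sum of 0 in G(0) and [e] in [C]. *)
have vert d e : hrec r (col_mx d 0) -> hrec r (col_mx d e) ->
    hrec r (col_mx 0 e).
  move=> /recP[c Cc dc] /recP[c' Cc' dc']; apply/recP; exists e.
    rewrite -(subrK c' e); apply: CD => //.
    by apply: bounded dc' dc _; rewrite sub0r opprK.
  by rewrite subrr; apply/recession_mapP => // a _; rewrite col_mx0 dot0r.
have xy : slice r x y.
  by rewrite sliceP; apply/addsetP; exists 0; rewrite ?subr0.
have [x' [xx' x'max]] := slice_maximal vert xy.
exists x'; rewrite -!sliceP; split=> //.
  by have := xx' _ xy; rewrite sliceP => /addsetP[c _ Ec]; exists (y - c).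
by move=> [x'']; rewrite -!sliceP => -[/x'max].
Qed.

Lemma homog_gr x y : F x y <-> hcone (homog s) (homvec (col_mx x y) 1).
Proof. by rewrite homog1 gr_slice. Qed.

Lemma homog_recession x y : G x y <-> hcone (homog s) (homvec (col_mx x y) 0).
Proof. by rewrite homog0 recession_mapP. Qed.

Theorem recession_bounded_has_solution : has_solution F C.
Proof.
have [gens gensP] := minkowski (homog s).
pose gx (g : 'cV[R]_(n + q + 1)) := usubmx (usubmx g).
pose gy (g : 'cV[R]_(n + q + 1)) := dsubmx (usubmx g).
pose gt (g : 'cV[R]_(n + q + 1)) := dsubmx g 0 0.
have gE g : g = homvec (col_mx (gx g) (gy g)) (gt g) by rewrite vsubmxK -homE.
have gensH g : g \in gens -> hcone (homog s) g by move=> /mem_gcone/gensP.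
have gensF g : g \in gens -> 0 < gt g -> F ((gt g)^-1 *: gx g) ((gt g)^-1 *: gy g).
  move=> /gensH gH g0; apply/gr_slice; rewrite /slice -scale_col_mx.
  by apply: homog_pos => //; rewrite -gE.
have gensG g : g \in gens -> gt g = 0 -> G (gx g) (gy g).
  by move=> /gensH gH g0; apply/homog_recession; rewrite -g0 -gE.
have gt_ge0 g : g \in gens -> 0 <= gt g.
  by move=> /gensH; rewrite {1}[g]gE => /homogP[].
have /choice[X XP] : forall g, exists x', g \in gens -> 0 < gt g ->
    minimizing_point F C x' /\
    addset (F ((gt g)^-1 *: gx g)) C `<=` addset (F x') C.
  move=> g; have [/andP[gg g0]|H] := boolP ((g \in gens) && (0 < gt g)); last first.
    by exists 0 => gg g0; rewrite gg g0 in H.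
  have [|x' [x'F xx' x'min]] :=
    @dominating_minimizer 1 F ((gt g)^-1 *: gx g) homog_gr.
    by exists ((gt g)^-1 *: gy g); apply: gensF.
  by exists x'.
(* The dominating minimizer may be 0, which is not admissible as a direction; minimality is
   therefore recorded only for nonzero [d]. *)
have /choice[D DP] : forall g, exists d, g \in gens -> gt g = 0 ->
    (d != 0 -> minimizing_direction F C d) /\
    addset (G (gx g)) C `<=` addset (G d) C.
  move=> g; have [/andP[gg /eqP g0]|H] := boolP ((g \in gens) && (gt g == 0)); last first.
    by exists 0 => gg /eqP g0; rewrite gg g0 in H.
  have [|d [dG gd dmin]] := @dominating_minimizer 0 G (gx g) homog_recession.
    by exists (gy g); apply: gensG.
  by exists d.
have [x0 [y0 Fxy0]] := dF.
have [|x1 [x1F _ x1min]] := @dominating_minimizer 1 F x0 homog_gr.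
  by exists y0.
(* Including [x1] makes [S] visibly nonempty. *)
pose S := [set x | x \in x1 :: [seq X g | g <- gens & 0 < gt g]].
pose T := [set d | d != 0 /\ d \in [seq D g | g <- gens & gt g == 0]].
have Smin : S `<=` minimizing_point F C.
  move=> x; rewrite /S /= inE => /orP[/eqP -> //|/mapP[g]].
  by rewrite mem_filter => /andP[g0 gg] ->; have [] := XP g gg g0.
have Tmin : T `<=` minimizing_direction F C.
  move=> d [d0 /mapP[g]]; rewrite mem_filter => /andP[/eqP g0 gg] E.
  by have [H _] := DP g gg g0; rewrite E in d0 *; apply: H.
exists S, T; split=> //; split.
- split; first exact: finite_seq.
  apply: (@sub_finite_set _ _ [set d | d \in [seq D g | g <- gens & gt g == 0]]).
    by move=> d [].
  exact: finite_seq.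
- by move=> x /Smin[].
- by exists x1; rewrite /S /= mem_head.
- by move=> d Td; split; [have [] := Tmin d Td|have [d0 _] := Td; apply/eqP].
move=> z [c Cc [f [x _ Fxf] <-]].
set YF := \bigcup_(x in S) F x; set YG := \bigcup_(x in T) G x.
(* A homogenized form of the infimizer inclusion, stable under sums and nonnegative multiples: [p]
   is the height times a point of the convex hull, and 0 at height 0. Height 1 gives the inclusion
   itself. *)
pose M (w : 'cV[R]_(n + q + 1)) := 0 <= gt w /\ exists c p r,
  [/\ C c, cone YG r, gy w = c + p + r &
      if gt w == 0 then p = 0 else Defs.conv YF ((gt w)^-1 *: p)].
have: M (homvec (col_mx x f) 1).
  apply: (@gcone_elim _ _ gens M); last exact/gensP/homog_gr.
  - split; first by rewrite /gt !mxE.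
    exists 0, 0, 0; split=> //; first exact: cone_zero.
    + by rewrite /gy !linear0 !addr0.
    + by rewrite /gt !mxE eqxx.
  - move=> u v [u0 [c1 [p1 [r1 [Cc1 Yr1 E1 P1]]]]].
    move=> [v0 [c2 [p2 [r2 [Cc2 Yr2 E2 P2]]]]].
    have gtD : gt (u + v) = gt u + gt v by rewrite /gt linearD mxE.
    split; first by rewrite gtD addr_ge0.
    exists (c1 + c2), (p1 + p2), (r1 + r2); split.
    + exact: CD.
    + exact: coneD.
    + rewrite /gy !linearD /= -/(gy u) -/(gy v) E1 E2.
      by rewrite addrACA (addrACA c1).
    + rewrite gtD; case: (eqVneq (gt u) 0) P1 => [-> ->|un P1].
        by rewrite !add0r; case: eqP P2.
      case: (eqVneq (gt v) 0) P2 => [-> ->|vn P2].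
        by rewrite !addr0 (negPf un).
      have up : 0 < gt u by rewrite lt_neqAle eq_sym un.
      have vp : 0 < gt v by rewrite lt_neqAle eq_sym vn.
      rewrite gt_eqF ?addr_gt0 //.
      have uvn : gt u + gt v != 0 by rewrite gt_eqF ?addr_gt0.
      (* The rescaled sum is the convex combination weighted by the two heights. *)
      have -> : (gt u + gt v)^-1 *: (p1 + p2) =
          (gt u / (gt u + gt v)) *: ((gt u)^-1 *: p1) +
          (gt v / (gt u + gt v)) *: ((gt v)^-1 *: p2).
        by rewrite scalerDr !scalerA; congr (_ *: _ + _ *: _); field; rewrite ?uvn ?un ?vn.
      apply: convD => //; try by rewrite divr_ge0 ?addr_ge0.
      by rewrite -mulrDl divff.
  - move=> t u t0 [u0 [c1 [p1 [r1 [Cc1 Yr1 E1 P1]]]]].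
    have gtZ : gt (t *: u) = t * gt u by rewrite /gt linearZ mxE.
    split; first by rewrite gtZ mulr_ge0.
    exists (t *: c1), (t *: p1), (t *: r1); split.
    + exact: CZ.
    + exact: coneZ.
    + by rewrite /gy !linearZ /= -/(gy u) E1 !scalerDr.
    + rewrite gtZ mulf_eq0; case: (eqVneq t 0) => [->|tn] /=.
        by rewrite scale0r.
      case: (eqVneq (gt u) 0) P1 => [_ ->|un P1]; first by rewrite scaler0.
      by rewrite scalerA invfM mulrAC mulVf // mul1r.
  - move=> g gg; split; first exact: gt_ge0.
    have [g0|gn] := eqVneq (gt g) 0.
      have [dmin /(_ (gy g))] := DP g gg g0; case.
        by apply/addsetP; exists 0 => //; rewrite subr0; apply: gensG.
      move=> e Ge [c' Cc' E].
      (* A direction replaced by 0 contributes only elements of G(0), which [C] absorbs. *)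
      have [d0|dn] := eqVneq (D g) 0.
        exists (e + c'), 0, 0; split=> //; first 1 last.
        + exact: cone_zero.
        + by rewrite !addr0 E.
        by apply: CD => //; apply: G0C; rewrite -d0.
      exists c', 0, e; split=> //; last by rewrite addr0 addrC.
      apply: subset_cone; exists (D g) => //; split=> //.
      by apply/mapP; exists g => //; rewrite mem_filter g0 eqxx.
    have gp : 0 < gt g by rewrite lt_neqAle eq_sym gn gt_ge0.
    have [xmin /(_ ((gt g)^-1 *: gy g))] := XP g gg gp; case.
      by apply/addsetP; exists 0 => //; rewrite subr0; apply: gensF.
    move=> e Fe [c' Cc' E].
    exists (gt g *: c'), (gt g *: e), 0; split.
    + by apply: CZ => //; apply: ltW.
    + exact: cone_zero.
    + by rewrite addr0 -scalerDr addrC E scalerA divff // scale1r.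
    + rewrite scalerA mulVf // scale1r; apply: subset_conv; exists (X g) => //.
      rewrite /S /= inE; apply/orP; right; apply/mapP; exists g => //.
      by rewrite mem_filter gp.
move=> [_ [c' [p [r [Cc' Yr]]]]].
rewrite /gy /gt homK col_mxKd hom_last oner_eq0 invr1 scale1r => -> Yp.
exists (c + c' + p); last by exists r => //; rewrite !addrA.
by exists (c + c'); [exact: CD|exists p].
Qed.

End Existence.

(** * The vectorial relaxation *)

Section Relaxation.
Context {R : realType} {n q : nat}.
Variables (F : 'cV[R]_n -> set 'cV[R]_q) (C : set 'cV[R]_q).
Variables (s : seq ('cV[R]_(n + q) * R)) (B : seq 'cV[R]_q).
Hypothesis FP : forall z, gr F z <-> hpoly s z.
Hypothesis CP : forall y, C y <-> hcone B y.
Hypothesis G0C : recession_map F 0 `<=` C.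

Theorem has_solutionP :
  has_solution F C <-> dom F !=set0 /\ recession_bounded F C.
Proof.
split=> [[S [T [[_ SF [x Sx] _ _] Smin _]]]|[dF bnd]].
  split; first by exists x; apply: SF.
  exact: (minimizing_point_recession_bounded FP CP G0C (Smin _ Sx)).
exact: recession_bounded_has_solution FP CP G0C dF bnd.
Qed.

Hypothesis dF : dom F !=set0.

(** In the variables [(x, u, v)], the first family says that [u] lies in F(x), the second that
    [v - u] lies in G(0). *)
Definition relaxation_system : seq ('cV[R]_(n + q + q) * R) :=
  [seq (col_mx c.1 0, c.2) | c <- s] ++
  [seq (col_mx (col_mx 0 (- dsubmx c.1)) (dsubmx c.1), 0) | c <- s].

Let G0P e : recession_map F 0 e <-> forall c, c \in s -> dot (dsubmx c.1) e <= 0.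
Proof.
rewrite (recession_mapP FP) //; split=> H c /H;
  by rewrite dot_split dot0r add0r.
Qed.

Lemma gr_relaxation z :
  gr (vectorial_relaxation F) z <-> hpoly relaxation_system z.
Proof.
rewrite /gr /vectorial_relaxation /=; set w := usubmx z; set v := dsubmx z.
have zE : z = col_mx w v by rewrite vsubmxK.
have -> : addset [set dsubmx w] (recession_map F 0) v <->
    recession_map F 0 (v - dsubmx w).
  split=> [[_ -> [g Gg <-]]|H]; first by rewrite addrC addKr.
  by exists (dsubmx w) => //; exists (v - dsubmx w); rewrite // addrC subrK.
rewrite (gr_slice FP) /slice vsubmxK G0P; split=> [[sw sv] c|H].
  rewrite mem_cat => /orP[] /mapP[a aS ->] /=; rewrite zE dot_col_mx.
    by rewrite dot0l addr0; apply: sw.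
  rewrite -[w]vsubmxK dot_col_mx dot0l add0r dotNl addrC -dotNr -dotDr.
  by rewrite -/(dsubmx w); apply: sv.
split=> c cs.
  have /H : (col_mx c.1 0, c.2) \in relaxation_system.
    by rewrite mem_cat; apply/orP; left; apply/mapP; exists c.
  by rewrite /= zE dot_col_mx dot0l addr0.
have /H : (col_mx (col_mx 0 (- dsubmx c.1)) (dsubmx c.1), 0) \in relaxation_system.
  by rewrite mem_cat; apply/orP; right; apply/mapP; exists c.
rewrite /= zE dot_col_mx -[w]vsubmxK dot_col_mx dot0l add0r dotNl addrC.
by rewrite -dotNr -dotDr vsubmxK.
Qed.

Lemma recession_map0 : recession_map F 0 0.
Proof. by apply/G0P => c _; rewrite dot0r. Qed.

Lemma dom_relaxation : dom (vectorial_relaxation F) !=set0.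
Proof.
have [x [y Fxy]] := dF; exists (col_mx x y), y.
rewrite /vectorial_relaxation /= col_mxKu col_mxKd; split=> //.
by exists y => //; exists 0; rewrite ?addr0 //; apply: recession_map0.
Qed.

(** Homogenizing turns the first family of [relaxation_system] into the description of the graph of
    G; the second is already homogeneous. *)
Lemma recession_map_relaxation x u v :
  recession_map (vectorial_relaxation F) (col_mx x u) v <->
  recession_map F x u /\ recession_map F 0 (v - u).
Proof.
rewrite (recession_mapP gr_relaxation) ?(recession_mapP FP x) //; last exact: dom_relaxation.
rewrite G0P; split=> [H|[sw sv] c].
  split=> c cs.
    have /H : (col_mx c.1 0, c.2) \in relaxation_system.
      by rewrite mem_cat; apply/orP; left; apply/mapP; exists c.
    by rewrite /= dot_col_mx dot0l addr0.
  have /H : (col_mx (col_mx 0 (- dsubmx c.1)) (dsubmx c.1), 0) \in relaxation_system.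
    by rewrite mem_cat; apply/orP; right; apply/mapP; exists c.
  by rewrite /= !dot_col_mx dot0l add0r dotNl addrC -dotNr -dotDr.
rewrite mem_cat => /orP[] /mapP[a aS ->] /=; rewrite dot_col_mx.
  by rewrite dot0l addr0; apply: sw.
rewrite dot_col_mx dot0l add0r dotNl addrC -dotNr -dotDr.
exact: sv.
Qed.

End Relaxation.

(** * Comparison of the criterion for the problem and for its relaxation *)

Unset Implicit Arguments.

Theorem corollary4p5 (R : realType) (n q : nat)
  (F : 'cV[R]_n -> set 'cV[R]_q) (C : set 'cV[R]_q)
  (hF : polyhedral_convex F)
  (hC : polyhedral_convex_cone C)
  (hreg : regular F C) :
  has_solution F C <->
  has_solution (vectorial_relaxation F) C /\ natural_ordering_cone F `<=` C.
Proof.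
have [s FP] := polyhedron_hpoly hF.
have [B CP] := polyhedral_convex_cone_hcone hC.
have [linC G0C] := hreg.
(* If [dom F] is empty, neither problem has a solution, since [S] must be a nonempty set of points
   of the domain. *)
have [dF|dF] := pselect (dom F !=set0); last first.
  split=> [[S [T [[_ SF [x /SF Fx] _ _] _ _]]]|]; first by case: dF; exists x.
  move=> [[S [T [[_ SF [z /SF[v [Fz _]]] _ _] _ _]]] _].
  by case: dF; exists (usubmx z), (dsubmx z).
have VP := gr_relaxation FP dF; have recV := recession_map_relaxation FP dF.
have dV := dom_relaxation FP dF.
have V0C : recession_map (vectorial_relaxation F) 0 `<=` C.
  by move=> v; rewrite -col_mx0 recV subr0 => -[_ /G0C].
rewrite (has_solutionP FP CP G0C) (has_solutionP VP CP V0C).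
split=> [[_ bnd]|[[_ bnd] KC]].
  have G0 := recession_map0 FP dF.
  split; last first.
    (* The inclusion of K in [C] is the case [w = 0] of the criterion. *)
    by move=> y [x [Gy G0x]]; apply: bnd Gy G0x _; rewrite oppr0; apply: (G0C 0).
  split=> // z v w; rewrite -(vsubmxK z) => /recV[Gu Gv] /recV[_ Gw] Cw.
  have CD := convex_coneD hC.2.
  (* With [u] the lower block of [z], [- u] is the sum of [w - u] in G(0) and [- w] in [C], so the
     criterion for F applies to [u] paired with itself. *)
  have Cu : C (dsubmx z).
    apply: (bnd _ _ _ Gu Gu); rewrite -(addKr w (- _)) addrC; apply: CD => //.
    exact: G0C.
  by rewrite -(subrK (dsubmx z) v); apply: CD => //; apply: G0C.
split=> // x y w Gy Gw Cw.
have G0 := recession_map0 FP dF.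
(* The relaxed criterion at [u = v = w] puts [w] in [C], hence [- w] in [lin C], which regularity
   places in G(0). *)
have Vw : recession_map (vectorial_relaxation F) (col_mx x w) w.
  by apply/recV; rewrite subrr.
have Cpw : C w by apply: (bnd _ _ _ Vw Vw Cw).
have GNw : recession_map F 0 (- w).
  by apply: linC; split=> //; exists w.
(* Adding [w] in G(x) and [- w] in G(0) gives 0 in G(x), so [y] belongs to K. *)
apply: KC; exists x; split=> //.
have /(recession_mapP FP) H1 := Gw; have /(recession_mapP FP) H2 := GNw.
apply/(recession_mapP FP) => // c cs.
have := H1 dF c cs; have := H2 dF c cs; rewrite !dot_split !dot0r dotNr; lra.
Qed.
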